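(* Fix positive integers $K$ and $d$, a level $\alpha\in(0,1)$ and a tolerance $\tau>0$. For each $n$, let $X_n\in\mathbb{R}^{n\times d}$, $y_n\in\mathbb{R}^n$ be deterministic, $\lambda_n>0$, let $\beta_n$ be the full-data ridge solution, let $m_{n,1}<\cdots<m_{n,K}$ be candidate sketch sizes, let $\widehat\beta_{n,j}:=\widehat\beta_{n,m_{n,j}}$ be the sketched ridge estimator at size $m_{n,j}$, and let $\widehat\epsilon_{n,j}(\alpha/K)$ be a nonnegative (random) error bound for $\widehat\beta_{n,j}$, $j=1,\dots,K$ (see the context). Define $\widehat j_n:=\min\{j\in\{1,\dots,K\}:\widehat\epsilon_{n,j}(\alpha/K)\le\tau\}$ if this set is nonempty, and $\widehat j_n:=0$ otherwise. Suppose that $m_{n,j}\to\infty$ as $n\to\infty$ for each $j=1,\dots,K$ and that $$\liminf_{n\to\infty}\mathbb{P}\big\{\|\widehat\beta_{n,j}-\beta_n\|_2\le\widehat\epsilon_{n,j}(\alpha/K)\big\}\ge1-\frac{\alpha}{K},\qquad j=1,\dots,K.$$ Then, regardless of dependence among the candidate sketches, $$\limsup_{n\to\infty}\mathbb{P}\Big(\bigcup_{j=1}^K\big\{\widehat j_n=j,\ \|\widehat\beta_{n,j}-\beta_n\|_2>\tau\big\}\Big)\le\alpha.$$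
   Context: Full-data ridge solution: $\beta_n:=(H_n+\lambda_nI_d)^{-1}g_n$ with $H_n:=\frac1nX_n^\top X_n$, $g_n:=\frac1nX_n^\top y_n$ (the minimizer over $\beta\in\mathbb{R}^d$ of $\frac1n\|X_n\beta-y_n\|_2^2+\lambda_n\|\beta\|_2^2$). Sketched ridge estimator at size $m$: given i.i.d. random sketch rows $s_{n,1},\dots,s_{n,m}\in\mathbb{R}^n$ with $\mathbb{E}(s_{n,1}s_{n,1}^\top)=I_n$, put $z_{n,i}:=n^{-1/2}X_n^\top s_{n,i}$, $u_{n,i}:=n^{-1/2}y_n^\top s_{n,i}$, $\widehat H_{n,m}:=\frac1m\sum_{i=1}^m z_{n,i}z_{n,i}^\top$, $\widehat g_{n,m}:=\frac1m\sum_{i=1}^m z_{n,i}u_{n,i}$, and $\widehat\beta_{n,m}:=(\widehat H_{n,m}+\lambda_nI_d)^{-1}\widehat g_{n,m}$. Each candidate size $m_{n,j}$ has its own sketch; sketches at different candidate sizes may be arbitrarily dependent (for example independent, or nested prefixes of one larger sketch). The error bound $\widehat\epsilon_{n,j}(\alpha/K)$ is any nonnegative random variable on the same probability space (in applications, a bootstrap error bound with nominal noncoverage probability $\alpha/K$). $\mathbb{P}$ is the joint probability over all sketches and any further randomness used to compute the error bounds. The value $\widehat j_n=0$ means that no candidate is selected. *)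

(* Defs.v *)
(* MathComp-Analysis; [R : realType] is the field of real numbers. *)
From HB Require Import structures.
From mathcomp Require Import all_boot all_order all_algebra.
From mathcomp Require Import all_classical all_reals all_analysis.

Set Implicit Arguments.
Unset Strict Implicit.
Unset Printing Implicit Defensive.

Import Order.TTheory GRing.Theory Num.Theory.
Import numFieldNormedType.Exports.

Local Open Scope classical_set_scope.
Local Open Scope ring_scope.

(* The library norm on matrices is the sup norm, hence this definition. *)
Definition norm2 (R : realType) (d : nat) (v : 'cV[R]_d) : R :=
  Num.sqrt (\sum_(k < d) v k 0 ^+ 2).

(* Below, [H] is positive semidefinite and [lam > 0], so [H + lam%:M] is
   invertible and [invmx] is a genuine inverse. *)
Definition ridge_solve (R : realType) (d : nat) (lam : R)
    (H : 'M[R]_d) (g : 'cV[R]_d) : 'cV[R]_d :=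
  invmx (H + lam%:M) *m g.

Definition ridge (R : realType) (n d : nat) (lam : R)
    (X : 'M[R]_(n, d)) (y : 'cV[R]_n) : 'cV[R]_d :=
  ridge_solve lam (n%:R^-1 *: (X^T *m X)) (n%:R^-1 *: (X^T *m y)).

Definition sketch_z (R : realType) (n d : nat)
    (X : 'M[R]_(n, d)) (s : 'cV[R]_n) : 'cV[R]_d :=
  (Num.sqrt n%:R)^-1 *: (X^T *m s).

Definition sketch_u (R : realType) (n : nat) (y s : 'cV[R]_n) : R :=
  (Num.sqrt n%:R)^-1 * (y^T *m s) 0 0.

Definition sketched_H (R : realType) (n d m : nat)
    (X : 'M[R]_(n, d)) (s : 'I_m -> 'cV[R]_n) : 'M[R]_d :=
  m%:R^-1 *: \sum_(i < m) sketch_z X (s i) *m (sketch_z X (s i))^T.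

Definition sketched_g (R : realType) (n d m : nat)
    (X : 'M[R]_(n, d)) (y : 'cV[R]_n) (s : 'I_m -> 'cV[R]_n) : 'cV[R]_d :=
  m%:R^-1 *: \sum_(i < m) sketch_u y (s i) *: sketch_z X (s i).

Definition sketched_ridge (R : realType) (n d m : nat) (lam : R)
    (X : 'M[R]_(n, d)) (y : 'cV[R]_n) (s : 'I_m -> 'cV[R]_n) : 'cV[R]_d :=
  ridge_solve lam (sketched_H X s) (sketched_g X y s).

(* Random vectors of R^n are random variables with values in [n.-tuple R],
   which carries the product Borel sigma-algebra; this reads such a value as a
   column vector. *)
Definition col_of_tuple (R : realType) (n : nat) (t : n.-tuple R) : 'cV[R]_n :=
  \col_(k < n) tnth t k.

Definition mutually_independent (R : realType) (d d' : measure_display)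
    (T : measurableType d) (T' : measurableType d') (P : probability T R)
    (I : finType) (X : I -> {RV P >-> T'}) : Prop :=
  forall (J : {set I}) (B : I -> set T'), (forall i, measurable (B i)) ->
    P (\bigcap_(i in [set` J]) X i @^-1` B i)
    = (\prod_(i in J) P (X i @^-1` B i))%E.

Definition identically_distributed (R : realType) (d d' : measure_display)
    (T : measurableType d) (T' : measurableType d') (P : probability T R)
    (I : finType) (X : I -> {RV P >-> T'}) : Prop :=
  forall (i k : I) (B : set T'), measurable B ->
    P (X i @^-1` B) = P (X k @^-1` B).

(* E (s s^T) = I_n, entrywise; the diagonal equations make all the products
   integrable. *)
Definition isotropic (R : realType) (d : measure_display)
    (T : measurableType d) (P : probability T R) (n : nat)
    (s : {RV P >-> n.-tuple R}) : Prop :=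
  forall a b : 'I_n,
    ('E_P[fun w => (tnth (s w) a * tnth (s w) b)%R] = ((a == b)%:R)%:E)%E.

(* Candidates are numbered from 1 to K, candidate j being the element of value
   j - 1 in ['I_K]; the value 0 means that no candidate is selected. *)
Definition selected_index (R : realType) (K : nat) (eps : 'I_K -> R) (tau : R)
    : nat :=
  if [pick j | eps j <= tau] is Some j0
  then (val [arg min_(j < j0 | (eps j <= tau)%R) val j]%N).+1
  else 0%N.

(* Main.v *)
(* If candidate j is selected then its error bound is at most tau, so an error
   exceeding tau exceeds the bound as well. The bad event thus lies in the union
   over j of the noncoverage events, which have asymptotic probability at most
   alpha / K each, whatever their dependence. The union bound needs these events
   to be measurable, because a measure is unconstrained elsewhere: the entries
   of an inverse matrix are rational functions of the entries, with a measurable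
   case distinction on the vanishing of the determinant. *)
Require Import Defs.
From HB Require Import structures.
From mathcomp Require Import all_boot all_order all_algebra.
From mathcomp Require Import all_classical all_reals all_analysis.
From mathcomp Require Import measurable_realfun.

Import Order.TTheory GRing.Theory Num.Theory.
Import numFieldNormedType.Exports.

Local Open Scope classical_set_scope.
Local Open Scope ring_scope.

(** Trades the minimization for finitely many inequalities. This serves twice: for the measurability
    of the selection event, and for the bound [eps j <= tau] at the selected candidate. *)
Lemma selected_indexP (R : realType) (K : nat) (eps : 'I_K -> R) (tau : R)
    (j : 'I_K) :
  selected_index eps tau = j.+1 <->
  eps j <= tau /\ forall k : 'I_K, (k < j)%N -> tau < eps k.
Proof.
rewrite /selected_index; case: pickP => [j0 j0tau|none]; last first.
  (* If no bound is within tolerance, the index is 0, never a successor, and the right-hand side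
     already fails at [j]. *)
  by split=> // -[jtau _]; rewrite none in jtau.
case: arg_minnP => //= i itau imin; split.
  move=> [/val_inj <-]; split=> // k ki; rewrite ltNge.
  by apply/negP => /imin; rewrite leqNgt ki.
move=> [jtau jmin]; congr _.+1; apply/eqP; rewrite eqn_leq (imin _ jtau) /=.
by rewrite leqNgt; apply/negP => /jmin; rewrite ltNge itau.
Qed.

(** * Upper and lower limits in the extended reals *)

Section Limits.
Set Implicit Arguments.
Unset Strict Implicit.
Context {R : realType}.
Implicit Types (u : (\bar R)^nat) (a : R).
Local Open Scope ereal_scope.

(** The upper limit is an infimum, over the sets [V] of the filter, of the supremum of [u] on [V].
    The set where [u n <= a + e] is one such [V]. *)
Lemma limn_esup_le u a :
  (forall e : R, (0 < e)%R -> \forall n \near \oo, u n <= (a + e)%:E) ->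
  limn_esup u <= a%:E.
Proof.
move=> ua; apply/lee_addgt0Pr => e /ua uae; rewrite -EFinD.
apply: le_trans (_ : ereal_sup (u @` [set n | u n <= (a + e)%:E]) <= _).
  by apply: ereal_inf_lbound; exists [set n | u n <= (a + e)%:E].
by apply: ge_ereal_sup => _ [n /= une <-].
Qed.

(** The lower limit is minus the upper limit of [\- u]. Giving up [e] makes the inequality strict,
    so some [V] in the infimum has supremum below [- (a - e)]. *)
Lemma limn_einf_ge u a (e : R) : a%:E <= limn_einf u -> (0 < e)%R ->
  \forall n \near \oo, (a - e)%:E <= u n.
Proof.
move=> au e0.
have : limn_esup (\- u) < (- (a - e))%:E.
  rewrite (@le_lt_trans _ _ (- a%:E))//; first by rewrite leeNr.
  by rewrite -EFinN lte_fin ltrN2 ltrBlDr ltrDl.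
move=> /ereal_inf_lt[_ [V Vinfty <-] supV].
apply: filterS Vinfty => n Vn; rewrite -leeN2 -EFinN.
by rewrite (le_trans _ (ltW supV))//; apply: ereal_sup_ubound; exists n.
Qed.

End Limits.

(** * Measurability of the estimator and of the events *)

Section Measurability.
Set Implicit Arguments.
Unset Strict Implicit.
Context {disp : measure_display} {T : measurableType disp} {R : realType}.

Lemma measurable_inv (f : T -> R) :
  measurable_fun setT f -> measurable_fun setT (fun w => (f w)^-1).
Proof.
(* Squaring makes the base nonnegative, where the real power of exponent -1 is the inverse. At a
   zero of [f] both sides are 0, since [0^-1 = 0]. *)
move=> mf; rewrite (_ : (fun _ => _) = fun w => f w * (f w ^+ 2) `^ (-1)).
  apply: measurable_funM => //.
  have mpow := measurable_powR (-1 : R).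
  by apply: (measurableT_comp mpow); exact: measurable_funX.
apply/funext => w; rewrite powR_inv1 ?sqr_ge0//.
have [->|fw0] := eqVneq (f w) 0; first by rewrite invr0 mul0r.
by rewrite expr2 invfM mulrA divff// mul1r.
Qed.

Lemma measurable_sqrt (f : T -> R) :
  measurable_fun setT f -> measurable_fun setT (fun w => Num.sqrt (f w)).
Proof.
move=> mf; have msqrt : measurable_fun setT (@Num.sqrt R).
  by apply: continuous_measurable_fun; exact: sqrt_continuous.
exact: (measurableT_comp msqrt).
Qed.

(** Working entrywise reduces every matrix operation to real-valued measurable functions. *)
Definition measurable_mx {p q : nat} (A : T -> 'M[R]_(p, q)) : Prop :=
  forall i j, measurable_fun setT (fun w => A w i j).

Lemma measurable_mx_cst p q (A : 'M[R]_(p, q)) : measurable_mx (fun=> A).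
Proof. by move=> i j; exact: measurable_cst. Qed.

Lemma measurable_mxD p q (A B : T -> 'M[R]_(p, q)) :
  measurable_mx A -> measurable_mx B -> measurable_mx (fun w => A w + B w).
Proof.
move=> mA mB i j; under eq_fun do rewrite mxE.
exact: measurable_funD.
Qed.

Lemma measurable_mxZ p q (c : T -> R) (A : T -> 'M[R]_(p, q)) :
  measurable_fun setT c -> measurable_mx A ->
  measurable_mx (fun w => c w *: A w).
Proof.
move=> mc mA i j; under eq_fun do rewrite mxE.
exact: measurable_funM.
Qed.

Lemma measurable_mx_sum p q (I : Type) (r : seq I)
    (A : I -> T -> 'M[R]_(p, q)) :
  (forall i, measurable_mx (A i)) ->
  measurable_mx (fun w => \sum_(i <- r) A i w).
Proof.
move=> mA i j; under eq_fun do rewrite summxE.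
by apply: measurable_sum => k; exact: mA.
Qed.

Lemma measurable_mx_tr p q (A : T -> 'M[R]_(p, q)) :
  measurable_mx A -> measurable_mx (fun w => (A w)^T).
Proof. by move=> mA i j; under eq_fun do rewrite mxE; exact: mA. Qed.

Lemma measurable_mxM p q r (A : T -> 'M[R]_(p, q)) (B : T -> 'M[R]_(q, r)) :
  measurable_mx A -> measurable_mx B -> measurable_mx (fun w => A w *m B w).
Proof.
move=> mA mB i j; under eq_fun do rewrite mxE.
by apply: measurable_sum => k; exact: measurable_funM.
Qed.

(** By the Leibniz expansion, the determinant is a polynomial in the entries. *)
Lemma measurable_det p (A : T -> 'M[R]_p) :
  measurable_mx A -> measurable_fun setT (fun w => \det (A w)).
Proof.
move=> mA; apply: measurable_sum => s; apply: measurable_funM => //.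
by apply: measurable_prod => i _; exact: mA.
Qed.

Lemma measurable_adj p (A : T -> 'M[R]_p) :
  measurable_mx A -> measurable_mx (fun w => \adj (A w)).
Proof.
move=> mA i j; under eq_fun do rewrite mxE.
apply: measurable_funM => //; apply: measurable_det => k l.
by under eq_fun do rewrite !mxE; exact: mA.
Qed.

Lemma measurable_invmx p (A : T -> 'M[R]_p) :
  measurable_mx A -> measurable_mx (fun w => invmx (A w)).
Proof.
move=> mA i j; have mdet := measurable_det mA.
(* Where the determinant vanishes, [invmx] returns its argument unchanged; elsewhere Cramer's
   formula applies. *)
rewrite (_ : (fun _ => _) = fun w =>
    if \det (A w) == 0 then A w i j else (\det (A w))^-1 * \adj (A w) i j).
  apply: measurable_fun_ifT; first exact: measurable_fun_eqr.
    exact: mA.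
  by apply: measurable_funM; [exact: measurable_inv|exact: measurable_adj].
apply/funext => w; rewrite /invmx unitmxE unitfE.
by case: eqP => //= _; rewrite mxE.
Qed.

Lemma measurable_norm2 p (v : T -> 'cV[R]_p) :
  measurable_mx v -> measurable_fun setT (fun w => norm2 (v w)).
Proof.
move=> mv; apply: measurable_sqrt; apply: measurable_sum => k.
exact: measurable_funX.
Qed.

Lemma measurable_sketched_ridge (n p m : nat) (lam : R) (X : 'M[R]_(n, p))
    (y : 'cV[R]_n) (s : 'I_m -> T -> 'cV[R]_n) :
  (forall i, measurable_mx (s i)) ->
  measurable_mx (fun w => sketched_ridge lam X y (fun i => s i w)).
Proof.
move=> ms.
have mz i : measurable_mx (fun w => sketch_z X (s i w)).
  by apply: measurable_mxZ => //; apply: measurable_mxM => //;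
    exact: measurable_mx_cst.
apply: measurable_mxM.
  apply: measurable_invmx; apply: measurable_mxD; last exact: measurable_mx_cst.
  apply: measurable_mxZ => //; apply: measurable_mx_sum => i.
  by apply: measurable_mxM => //; exact: measurable_mx_tr.
apply: measurable_mxZ => //; apply: measurable_mx_sum => i.
apply: measurable_mxZ => //; apply: measurable_funM => //.
by apply: measurable_mxM => //; exact: measurable_mx_cst.
Qed.

Lemma measurable_mx_col_of_tuple (n : nat) (s : T -> n.-tuple R) :
  measurable_fun setT s -> measurable_mx (fun w => col_of_tuple (s w)).
Proof.
move=> ms i j; under eq_fun do rewrite mxE.
exact: (measurableT_comp (measurable_tnth i)).
Qed.

Lemma measurable_pred (b : T -> bool) :
  measurable_fun setT b -> measurable [set w | b w].
Proof.
move=> mb; rewrite (_ : [set _ | _] = b @^-1` [set true]) //.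
by rewrite -[X in measurable X]setTI; exact: mb.
Qed.

Lemma measurable_selected_index (K : nat) (eps : 'I_K -> T -> R) (tau : R)
    (j : 'I_K) : (forall k, measurable_fun setT (eps k)) ->
  measurable [set w | selected_index (eps ^~ w) tau = j.+1].
Proof.
move=> meps; rewrite (_ : [set _ | _] = [set w | eps j w <= tau] `&`
    \bigcap_(k in [set k : 'I_K | (k < j)%N]) [set w | tau < eps k w]).
  apply: measurableI; first by apply: measurable_pred; exact: measurable_fun_ler.
  apply: fin_bigcap_measurable => // k _.
  by apply: measurable_pred; exact: measurable_fun_ltr.
by apply/seteqP; split=> w /selected_indexP.
Qed.

(** The non-asymptotic core, on a single probability space. The noncoverage levels [a j] are
    arbitrary, so that they can later include the slack left by the lower limit. *)
Lemma selection_failure_le (K : nat) (P : probability T R)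
    (err eps : 'I_K -> T -> R) (tau : R) (a : 'I_K -> R) :
  (forall j, measurable_fun setT (err j)) ->
  (forall j, measurable_fun setT (eps j)) ->
  (forall j, ((1 - a j)%:E <= P [set w | (err j w <= eps j w)%R])%E) ->
  (P (\bigcup_(j in [set: 'I_K])
        [set w | selected_index (eps ^~ w) tau = j.+1 /\
                   (tau < err j w)%R])
   <= (\sum_(j < K) a j)%:E)%E.
Proof.
move=> merr meps cov.
have mcov j : measurable [set w | err j w <= eps j w].
  by apply: measurable_pred; exact: measurable_fun_ler.
apply: (@le_trans _ _
  (\sum_(j < K) P (~` [set w | (err j w <= eps j w)%R]))%E).
  (* The union bound is stated for sums over finite sets, hence the passage from the enumeration of
     ['I_K] to its underlying set. *)
  rewrite fsbig_seq ?index_enum_uniq//; apply: content_sub_fsum => //.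
  - by move=> j _; exact: measurableC.
  - apply: fin_bigcup_measurable => // j _; apply: measurableI.
      exact: measurable_selected_index.
    by apply: measurable_pred; exact: measurable_fun_ltr.
  - move=> w [j _ [/selected_indexP[epstau _] tauerr]]; exists j.
      by rewrite /= mem_index_enum.
    by apply/negP; rewrite /= -ltNge (le_lt_trans epstau).
rewrite -sumEFin; apply: lee_sum => j _.
rewrite probability_setC// leeBlDr ?fin_num_measure//.
by rewrite -leeBlDl// -EFinB.
Qed.

End Measurability.

Theorem theorem3 (R : realType) (K d : nat) (hK : (0 < K)%N) (hd : (0 < d)%N)
    (alpha tau : R) (halpha : 0 < alpha < 1) (htau : 0 < tau)
    (X : forall n : nat, 'M[R]_(n, d)) (y : forall n : nat, 'cV[R]_n)
    (lam : nat -> R) (hlam : forall n : nat, (0 < n)%N -> 0 < lam n)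
    (m : nat -> 'I_K -> nat)
    (hm_pos : forall (n : nat) (j : 'I_K), (0 < n)%N -> (0 < m n j)%N)
    (hm_incr : forall (n : nat) (j k : 'I_K),
        (0 < n)%N -> (j < k)%N -> (m n j < m n k)%N)
    (disp : nat -> measure_display)
    (T : forall n : nat, measurableType (disp n))
    (P : forall n : nat, probability (T n) R)
    (S : forall (n : nat) (j : 'I_K), 'I_(m n j) -> {RV (P n) >-> n.-tuple R})
    (hS_indep : forall (n : nat) (j : 'I_K),
        (0 < n)%N -> mutually_independent (S n j))
    (hS_ident : forall (n : nat) (j : 'I_K),
        (0 < n)%N -> identically_distributed (S n j))
    (hS_isotropic : forall (n : nat) (j : 'I_K) (i : 'I_(m n j)),
        (0 < n)%N -> isotropic (S n j i))
    (eps : forall (n : nat), 'I_K -> R -> {RV (P n) >-> R})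
    (heps : forall (n : nat) (j : 'I_K) (w : T n),
        (0 < n)%N -> 0 <= eps n j (alpha / K%:R) w)
    (hm_infty : forall j : 'I_K, (fun n : nat => m n j) @ \oo --> \oo) :
  let beta (n : nat) : 'cV[R]_d := ridge (lam n) (X n) (y n) in
  let betahat (n : nat) (j : 'I_K) (w : T n) : 'cV[R]_d :=
    sketched_ridge (lam n) (X n) (y n) (fun i => col_of_tuple (S n j i w)) in
  let jhat (n : nat) (w : T n) : nat :=
    selected_index (fun j : 'I_K => eps n j (alpha / K%:R) w) tau in
  (forall j : 'I_K,
    ((1 - alpha / K%:R)%:E <=
     limn_einf (fun n : nat =>
       P n [set w | (norm2 (betahat n j w - beta n)
                     <= eps n j (alpha / K%:R) w)%R]))%E) ->
  (limn_esup (fun n : nat =>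
     P n (\bigcup_(j in [set: 'I_K])
            [set w | jhat n w = j.+1 /\
                     (tau < norm2 (betahat n j w - beta n))%R]))
   <= alpha%:E)%E.
Proof.
move=> beta betahat jhat cov; apply: limn_esup_le => e e0.
have merr n j : measurable_fun setT (fun w => norm2 (betahat n j w - beta n)).
  apply: measurable_norm2; apply: measurable_mxD; last exact: measurable_mx_cst.
  apply: measurable_sketched_ridge => i.
  exact: measurable_mx_col_of_tuple.
have K0 : K%:R != 0 :> R by rewrite pnatr_eq0 -lt0n.
(* The slack [e] is shared equally among the candidates, so that the [K] levels [alpha / K + e / K]
   add up to [alpha + e]. *)
have eK0 : 0 < e / K%:R by rewrite divr_gt0// ltr0n.
have covn : \forall n \near \oo, forall j : 'I_K,
    ((1 - (alpha / K%:R + e / K%:R))%:E <=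
     P n [set w | (norm2 (betahat n j w - beta n)
                   <= eps n j (alpha / K%:R) w)%R])%E.
  (* There are finitely many candidates, so a single threshold on [n] works for all of them. *)
  apply: filter_forall => j.
  by have := limn_einf_ge (cov j) eK0; rewrite -addrA -opprD.
apply: filterS covn => n covn.
apply: le_trans (selection_failure_le tau (merr n) _ covn) _.
  by move=> j; exact: measurable_funP.
by rewrite sumr_const card_ord -mulrDl -[X in X%:E]mulr_natr divfK.
Qed.
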